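(* Let $M$ be a complete semi-uniformly visible CAT(0) space and let $\gamma$ be an isometry of $M$. Then: (1) $\gamma$ is elliptic if and only if $\gamma$ has a fixed point in $M$. (2) $\gamma$ is hyperbolic if and only if $|\gamma|>0$. (3) $\gamma$ is parabolic if and only if $|\gamma|=0$ and $\gamma$ does not have any fixed point in $M$.
   Context: $M$ is not assumed to be proper (locally compact). For a complete CAT(0) space $M$, $M(\infty)$ denotes the visual boundary, i.e. the set of equivalence classes of asymptotic unit-speed geodesic rays; $c(+\infty)$ denotes the class of a ray $c$, and for a geodesic line $c:\mathbb{R}\to M$, $c(-\infty)$ is the class of $t\mapsto c(-t)$, $t\ge 0$. $M$ is visible if for any $x\neq y$ in $M(\infty)$ there is a geodesic line $c:\mathbb{R}\to M$ with $c(-\infty)=x$ and $c(+\infty)=y$ (in particular $M$ is visible if $M(\infty)=\emptyset$). $M$ has an infinite-flat-strip if there is a totally geodesic convex subset of $M$ that is isometric to a metric product $U\times\mathbb{R}$ with $U$ unbounded. $M$ is semi-uniformly visible if it is visible and has no infinite-flat-strip. An isometry is a distance-preserving bijection $\gamma:M\to M$; its translation length is $|\gamma|:=\inf_{p\in M} dist(\gamma\cdot p,p)$. It is elliptic if it has a fixed point in $M$; hyperbolic if there is a geodesic line $c:\mathbb{R}\to M$ such that $\gamma$ acts on $c(\mathbb{R})$ by a non-trivial translation; parabolic if it is neither elliptic nor hyperbolic. *)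

(* Defs.v *)
From HB Require Import structures.
From mathcomp Require Import all_boot all_order all_algebra.
From mathcomp Require Import all_classical all_reals all_analysis.
From mathcomp Require Import ring lra.

Set Implicit Arguments.
Unset Strict Implicit.
Unset Printing Implicit Defensive.

Import Order.TTheory GRing.Theory Num.Theory.
Import numFieldNormedType.Exports.

Local Open Scope classical_set_scope.
Local Open Scope ring_scope.

#[short(type="completeMetricType")]
HB.structure Definition CompleteMetric (R : numDomainType) :=
  { T of Complete T & Metric R T }.

(* [U * V] carries the sup metric in the library; the metric product is put on
   the alias [l2prod U V]. *)
Definition l2prod (U V : Type) : Type := (U * V)%type.

Section L2Prod.
Context {R : realType} (U V : metricType R).

Definition l2dist (p q : l2prod U V) : R :=
  Num.sqrt (mdist p.1 q.1 ^+ 2 + mdist p.2 q.2 ^+ 2).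

Lemma l2distxx p : l2dist p p = 0.
Proof. by rewrite /l2dist !mdistxx expr0n addr0 sqrtr0. Qed.

Lemma l2dist_positivity p q : l2dist p q = 0 -> p = q.
Proof.
case: p q => [p1 p2] [q1 q2]; rewrite /l2dist /= => /eqP.
rewrite sqrtr_eq0 => h.
have h1 := sqr_ge0 (mdist p1 q1); have h2 := sqr_ge0 (mdist p2 q2).
have /eqP : mdist p1 q1 ^+ 2 = 0 by lra.
rewrite sqrf_eq0 => /eqP /mdist_positivity ->.
have /eqP : mdist p2 q2 ^+ 2 = 0 by lra.
by rewrite sqrf_eq0 => /eqP /mdist_positivity ->.
Qed.

Lemma l2dist_sym p q : l2dist p q = l2dist q p.
Proof. by rewrite /l2dist metric_sym (metric_sym p.2). Qed.

Lemma minkowski2 (a b c d : R) :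
  Num.sqrt ((a + c) ^+ 2 + (b + d) ^+ 2) <=
  Num.sqrt (a ^+ 2 + b ^+ 2) + Num.sqrt (c ^+ 2 + d ^+ 2).
Proof.
have ge0 (x y : R) : 0 <= x ^+ 2 + y ^+ 2 by rewrite addr_ge0 ?sqr_ge0.
rewrite -(@ler_pXn2r _ 2) ?nnegrE ?addr_ge0 ?sqrtr_ge0 // sqr_sqrtr //.
rewrite [leRHS]sqrrD !sqr_sqrtr // -sqrtrM //.
have cs : a * c + b * d <= Num.sqrt ((a ^+ 2 + b ^+ 2) * (c ^+ 2 + d ^+ 2)).
  apply: (le_trans (ler_norm _)); rewrite -sqrtr_sqr ler_sqrt ?mulr_ge0 //.
  have := sqr_ge0 (a * d - b * c); lra.
lra.
Qed.

Lemma l2dist_triangle q p r : l2dist p r <= l2dist p q + l2dist q r.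
Proof.
apply: le_trans (minkowski2 _ _ _ _); apply: ler_wsqrtr.
by apply: lerD; rewrite ler_pXn2r ?nnegrE ?addr_ge0 ?mdist_ge0 //;
  exact: metric_triangle.
Qed.

HB.instance Definition _ := Choice.copy (l2prod U V) (U * V)%type.
HB.instance Definition _ := @isMetric.Build R (l2prod U V) l2dist
  l2distxx l2dist_positivity l2dist_sym l2dist_triangle.

End L2Prod.

Definition euclidean_plane (R : realType) : metricType R := l2prod R^o R^o.

Section Geodesics.
Context {R : realType} (M : metricType R).

Definition geodesic_on (D : set R) (c : R -> M) : Prop :=
  forall s t, D s -> D t -> mdist (c s) (c t) = `|s - t|.

Definition geodesic_segment (x y : M) (c : R -> M) : Prop :=
  [/\ c 0 = x, c (mdist x y) = y & geodesic_on `[0, mdist x y] c].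

Definition geodesic_ray (c : R -> M) : Prop := geodesic_on `[0, +oo[ c.

Definition geodesic_line (c : R -> M) : Prop := geodesic_on setT c.

Definition geodesic_space : Prop :=
  forall x y : M, exists c, geodesic_segment x y c.

Definition convex_subset (S : set M) : Prop :=
  forall x y, S x -> S y ->
    (exists c, geodesic_segment x y c) /\
    (forall c, geodesic_segment x y c -> c @` `[0, mdist x y] `<=` S).

(* [ordS] is the cyclic successor: side [i] joins vertex [i] to the next one. *)
Definition geodesic_triangle (v : 'I_3 -> M) (c : 'I_3 -> R -> M) : Prop :=
  forall i, geodesic_segment (v i) (v (ordS i)) (c i).

Definition unbounded_space : Prop :=
  ~ exists K : R, forall x y : M, mdist x y <= K.

End Geodesics.

(* The points [c' i s] and [c' j t] are the comparison points of [c i s] and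
   [c j t]. *)
Definition CAT0 {R : realType} (M : metricType R) : Prop :=
  geodesic_space M /\
  forall (v : 'I_3 -> M) c (v' : 'I_3 -> euclidean_plane R) c',
    geodesic_triangle v c -> geodesic_triangle v' c' ->
    (forall i j, mdist (v' i) (v' j) = mdist (v i) (v j)) ->
    forall i j (s t : R),
      0 <= s <= mdist (v i) (v (ordS i)) ->
      0 <= t <= mdist (v j) (v (ordS j)) ->
      mdist (c i s) (c j t) <= mdist (c' i s) (c' j t).

Definition distance_preserving {R : realType} (M N : metricType R)
    (f : M -> N) : Prop :=
  forall x y, mdist (f x) (f y) = mdist x y.

Section Visibility.
Context {R : realType} (M : metricType R).

Definition asymptotic (c c' : R -> M) : Prop :=
  exists K, forall t, 0 <= t -> mdist (c t) (c' t) <= K.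

(* Rays are functions on all of [R] whose values at negative arguments are
   irrelevant, so a geodesic line represents its own endpoint at [+oo]. *)
Definition endpoint (c : R -> M) : set (R -> M) :=
  [set c' | geodesic_ray c' /\ asymptotic c c'].

Definition visual_boundary : set (set (R -> M)) :=
  [set endpoint c | c in [set c | geodesic_ray c]].

Definition visible : Prop :=
  forall x y, visual_boundary x -> visual_boundary y -> x <> y ->
    exists c, [/\ geodesic_line c, endpoint (fun t => c (- t)) = x &
                  endpoint c = y].

(* Distances on [S] are those of [M], so geodesics of a convex [S] are geodesics
   of [M]: total geodesicity is part of convexity. *)
Definition has_infinite_flat_strip : Prop :=
  exists (S : set M) (U : metricType R) (f : l2prod U R^o -> M),
    [/\ convex_subset S, unbounded_space U, distance_preserving f &
        range f = S].

Definition semi_uniformly_visible : Prop :=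
  visible /\ ~ has_infinite_flat_strip.

End Visibility.

Section Isometries.
Context {R : realType} (M : metricType R) (g : M -> M).

Definition metric_isometry : Prop := bijective g /\ distance_preserving g.

Definition translation_length : R := inf (range (fun p => mdist (g p) p)).

Definition elliptic : Prop := exists p, g p = p.

Definition hyperbolic : Prop :=
  exists c, geodesic_line c /\
    exists2 a : R, a != 0 & forall t, g (c t) = c (t + a).

Definition parabolic : Prop := ~ elliptic /\ ~ hyperbolic.

End Isometries.

(* Main.v *)
(** Suppose [0 < |g|]. The orbit [g^n x] escapes linearly, at speed [|g|], so by
    the Karlsson-Margulis argument the segments from [x] to [g^n x] converge to a
    ray [r] with [g r] asymptotic to [r]; the inverse of [g] gives another ray,
    which is not asymptotic to [r] because [d(g^n x, g^-n x)] is at least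
    [2n|g|]. Visibility joins their ends by a line [c0], and [g c0] is parallel
    to [c0]. The lines parallel to [c0] form a convex product [U * R] on which
    [g] acts through an isometry of [U] and a translation. Without infinite flat
    strips [U] is bounded, hence the action on [U] fixes a circumcenter, that is,
    [g] translates a line, nontrivially since [0 < |g|].

    All the geometry is drawn from the inequality of Bruhat and Tits
    [between_cn]. *)
From HB Require Import structures.
Require Import Defs.
From mathcomp Require Import all_boot all_order all_algebra.
From mathcomp Require Import all_classical all_reals all_analysis.
From mathcomp Require Import ring lra zify.

Set Implicit Arguments.
Unset Strict Implicit.
Unset Printing Implicit Defensive.

Import Order.TTheory GRing.Theory Num.Theory.
Import numFieldNormedType.Exports.

Local Open Scope classical_set_scope.
Local Open Scope ring_scope.

(** * Segments of the Euclidean plane *)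

Section PlaneSegments.
Context {R : realType}.

Lemma plane_mdistE (p q : euclidean_plane R) :
  mdist p q = Num.sqrt ((p.1 - q.1) ^+ 2 + (p.2 - q.2) ^+ 2).
Proof.
rewrite [LHS]/mdist /= /l2dist /= /mdist /= !real_normK ?num_real //.
by rewrite -(sqrrN (p.1 - _)) -(sqrrN (p.2 - _)) !opprB.
Qed.

(* When [p = q] the quotient is [0] and the segment is constant. *)
Definition plane_segment (p q : euclidean_plane R) (s : R) :
    euclidean_plane R :=
  (p.1 + s / mdist p q * (q.1 - p.1), p.2 + s / mdist p q * (q.2 - p.2)).

Lemma plane_segment_geodesic (p q : euclidean_plane R) :
  geodesic_segment p q (plane_segment p q).
Proof.
have [pq0|pq0] := eqVneq (mdist p q) 0.
  have pq := mdist_positivity _ _ pq0.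
  split; rewrite /plane_segment ?pq0.
  - by rewrite invr0 !mulr0 !mul0r !addr0; case: (p).
  - by rewrite invr0 !mulr0 !mul0r !addr0 -pq; case: (p).
  - move=> s t /=; rewrite !in_itv /= -pq => /andP[s0 s1] /andP[t0 t1].
    rewrite invr0 !mulr0 !mul0r !addr0.
    have -> : s = t by lra.
    by rewrite subrr normr0 mdistxx.
split; rewrite /plane_segment.
- by rewrite !mul0r !addr0; case: (p).
- by rewrite divff // !mul1r !subrKC; case: (q).
- move=> s t _ _; rewrite plane_mdistE /=.
  have -> : (p.1 + s / mdist p q * (q.1 - p.1) -
             (p.1 + t / mdist p q * (q.1 - p.1))) ^+ 2 +
            (p.2 + s / mdist p q * (q.2 - p.2) -
             (p.2 + t / mdist p q * (q.2 - p.2))) ^+ 2 =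
            ((s - t) / mdist p q) ^+ 2 *
            ((p.1 - q.1) ^+ 2 + (p.2 - q.2) ^+ 2) by ring.
  rewrite sqrtrM ?sqr_ge0 // -plane_mdistE sqrtr_sqr normrM normfV.
  by rewrite (ger0_norm (mdist_ge0 p q)) mulfVK.
Qed.

End PlaneSegments.

(** * Points dividing a segment in a given ratio *)

Section Between.
Context {R : realType} {M : metricType R}.

(** Encoded by two distances rather than by a chosen geodesic, so that isometries carry it over at
    once; in a CAT(0) space such an [m] exists and is unique for [0 <= l <= 1]. *)
Definition between (l : R) (x y m : M) : Prop :=
  mdist x m = l * mdist x y /\ mdist m y = (1 - l) * mdist x y.

Lemma between_sym l x y m : between l x y m -> between (1 - l) y x m.
Proof.
by case=> h1 h2; split; rewrite metric_sym ?h1 ?h2 (metric_sym y x) // subKr.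
Qed.

Lemma segment_between (x y : M) c l : geodesic_segment x y c -> 0 <= l <= 1 ->
  between l x y (c (l * mdist x y)).
Proof.
move=> [c0 c1 gc] /andP[l0 l1]; have xy0 := mdist_ge0 x y.
have H : 0 <= l * mdist x y <= mdist x y.
  by rewrite mulr_ge0 //= ler_piMl.
split.
- rewrite -{1}c0 gc /= ?in_itv /= ?lexx ?xy0 //.
  by rewrite sub0r normrN ger0_norm ?mulr_ge0.
- rewrite -{2}c1 gc /= ?in_itv /= ?lexx ?xy0 //.
  by rewrite distrC ger0_norm ?subr_ge0 ?(andP H).2 //; lra.
Qed.

Lemma isometry_between (g : M -> M) l x y m : distance_preserving g ->
  between l x y m -> between l (g x) (g y) (g m).
Proof. by move=> gd [h1 h2]; split; rewrite !gd. Qed.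

End Between.

(** * The Bruhat-Tits inequality and convexity of the distance *)

Section ComparisonInequality.
Context {R : realType} {M : metricType R}.
Hypothesis catM : CAT0 M.

Lemma CAT0_segment (x y : M) : exists c, geodesic_segment x y c.
Proof. exact: catM.1. Qed.

Lemma comparison_triangle (x y z : M) : x != y ->
  exists w : R * R, let p : euclidean_plane R := (0, 0) in
    let q : euclidean_plane R := (mdist x y, 0) in
    mdist p q = mdist x y /\ mdist p (w : euclidean_plane R) = mdist x z /\
    mdist q (w : euclidean_plane R) = mdist y z.
Proof.
rewrite -mdist_gt0 => xy; set D := mdist x y; set a := mdist x z.
set b := mdist y z.
have a0 : 0 <= a by exact: mdist_ge0.
have b0 : 0 <= b by exact: mdist_ge0.
have t1 : a <= D + b by exact: metric_triangle.
have t2 : b <= D + a by rewrite /D metric_sym; exact: metric_triangle.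
have t3 : D <= a + b by rewrite /b (metric_sym y); exact: metric_triangle.
(* Abscissa of the third vertex by the law of cosines; the triangle inequalities give [|u| <= a], so
   that the ordinate is a real square root. *)
pose u := (a ^+ 2 + D ^+ 2 - b ^+ 2) / (2 * D).
have uD : 2 * D * u = a ^+ 2 + D ^+ 2 - b ^+ 2.
  by rewrite /u mulrC divfK // mulf_neq0 // gt_eqF.
have ua : `|u| <= a.
  have D2 : 0 < 2 * D by rewrite mulr_gt0.
  rewrite ler_norml; apply/andP; split; rewrite -(ler_pM2l D2) uD; nra.
have w0 : 0 <= a ^+ 2 - u ^+ 2.
  by rewrite subr_ge0 -(real_normK (num_real u)) ler_pXn2r ?nnegrE.
exists (u, Num.sqrt (a ^+ 2 - u ^+ 2)) => /=.
rewrite !plane_mdistE /=; split; last split.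
- by rewrite subrr expr0n addr0 sub0r sqrrN sqrtr_sqr gtr0_norm.
- by rewrite !sub0r !sqrrN sqr_sqrtr // subrKC sqrtr_sqr ger0_norm.
- rewrite sub0r sqrrN sqr_sqrtr //.
  have -> : (D - u) ^+ 2 + (a ^+ 2 - u ^+ 2) = b ^+ 2 by nra.
  by rewrite sqrtr_sqr ger0_norm.
Qed.

Lemma ord3_cases (i : 'I_3) : [\/ i = 0, i = 1 | i = 2%:R].
Proof.
case: i => [[|[|[|//]]] h]; [constructor 1|constructor 2|constructor 3];
  exact: val_inj.
Qed.

(** Comparison of a point of a side with the opposite vertex; in the plane equality holds, by
    Stewart's theorem. *)
Lemma segment_cn (x y z : M) c l : geodesic_segment x y c -> 0 <= l <= 1 ->
  mdist z (c (l * mdist x y)) ^+ 2 <=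
  (1 - l) * mdist z x ^+ 2 + l * mdist z y ^+ 2 - l * (1 - l) * mdist x y ^+ 2.
Proof.
move=> cxy l01; have /andP[l0 l1] := l01.
have [xy|xy] := eqVneq x y.
  have c0 : c (l * mdist x y) = x by rewrite {1}xy mdistxx mulr0; case: cxy.
  rewrite c0 -xy mdistxx; lra.
have [w [pq [pw qw]]] := comparison_triangle z xy.
set p : euclidean_plane R := (0, 0) in pq pw.
set q : euclidean_plane R := (mdist x y, 0) in pq qw.
have [c1 yz] := CAT0_segment y z; have [c2 zx] := CAT0_segment z x.
pose v (i : 'I_3) : M := if i == 0 then x else if i == 1 then y else z.
pose v' (i : 'I_3) : euclidean_plane R :=
  if i == 0 then p else if i == 1 then q else w.
pose cc (i : 'I_3) := if i == 0 then c else if i == 1 then c1 else c2.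
pose cc' (i : 'I_3) := plane_segment (v' i) (v' (ordS i)).
have S0 : ordS (0 : 'I_3) = 1 by exact: val_inj.
have S1 : ordS (1 : 'I_3) = 2%:R by exact: val_inj.
have S2 : ordS (2%:R : 'I_3) = 0 by exact: val_inj.
have T1 : geodesic_triangle v cc.
  by move=> i; case: (ord3_cases i) => ->; rewrite ?S0 ?S1 ?S2.
have T2 : geodesic_triangle v' cc'.
  by move=> i; exact: plane_segment_geodesic.
have dv : forall i j, mdist (v' i) (v' j) = mdist (v i) (v j).
  move=> i j; case: (ord3_cases i) => ->; case: (ord3_cases j) => ->;
  rewrite /v /v' /= ?mdistxx //.
  - by rewrite metric_sym pq metric_sym.
  - by rewrite metric_sym pw metric_sym.
  - by rewrite metric_sym qw metric_sym.
have D0 : 0 < mdist x y by rewrite mdist_gt0.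
(* Side 2 runs from [z] to [x], so its parameter 0 is the vertex [z]. *)
have := catM.2 v cc v' cc' T1 T2 dv 0 2%:R (l * mdist x y) 0.
rewrite S0 S2 /v /= lexx mdist_ge0 mulr_ge0 ?mdist_ge0 //.
rewrite ler_piMl ?mdist_ge0 //.
move=> /(_ isT isT); rewrite /cc /=.
have -> : c2 0 = z by case: zx.
have -> : cc' 0 (l * mdist x y) = (l * mdist x y, 0).
  rewrite /cc' S0 /v' /= /plane_segment pq /= subrr mulr0 addr0 add0r subr0.
  by rewrite mulfVK // gt_eqF.
have -> : cc' 2%:R 0 = w by case: (T2 2%:R).
rewrite metric_sym => H.
apply: le_trans
  (_ : mdist ((l * mdist x y, 0) : euclidean_plane R) w ^+ 2 <= _).
  by rewrite ler_pXn2r ?nnegrE ?mdist_ge0.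
have E (s t : euclidean_plane R) : mdist s t ^+ 2 =
    (s.1 - t.1) ^+ 2 + (s.2 - t.2) ^+ 2.
  by rewrite plane_mdistE sqr_sqrtr // addr_ge0 ?sqr_ge0.
have := congr1 (fun r => r ^+ 2) pw; have := congr1 (fun r => r ^+ 2) qw.
rewrite /= !E /= !(metric_sym z) => <- <-.
by rewrite le_eqVlt; apply/orP; left; apply/eqP; ring.
Qed.

(** At [z := m] the right-hand side of [segment_cn] vanishes, so [m] lies on the chosen segment and
    [segment_cn] applies to it. *)
Lemma between_cn l (x y m z : M) : 0 <= l <= 1 -> between l x y m ->
  mdist z m ^+ 2 <=
  (1 - l) * mdist z x ^+ 2 + l * mdist z y ^+ 2 - l * (1 - l) * mdist x y ^+ 2.
Proof.
move=> l01 [xm my]; have [c cxy] := CAT0_segment x y.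
have := segment_cn m cxy l01; rewrite (metric_sym m x) xm my.
have -> : (1 - l) * (l * mdist x y) ^+ 2 + l * ((1 - l) * mdist x y) ^+ 2 -
  l * (1 - l) * mdist x y ^+ 2 = 0 by ring.
move=> h; have /eqP : mdist m (c (l * mdist x y)) ^+ 2 = 0.
  by apply/eqP; rewrite eq_le h sqr_ge0.
by rewrite sqrf_eq0 => /eqP /mdist_positivity ->; exact: segment_cn.
Qed.

Lemma between_exists l (x y : M) : 0 <= l <= 1 -> exists m, between l x y m.
Proof.
move=> l01; have [c cxy] := CAT0_segment x y.
by exists (c (l * mdist x y)); exact: segment_between.
Qed.

Lemma between_unique l (x y m m' : M) : 0 <= l <= 1 ->
  between l x y m -> between l x y m' -> m = m'.
Proof.
move=> l01 [xm my] /between_cn - /(_ m l01).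
rewrite (metric_sym m x) xm my => h; apply: mdist_positivity; apply/eqP.
rewrite -sqrf_eq0 eq_le sqr_ge0 andbT; apply: le_trans h _.
by rewrite le_eqVlt; apply/orP; left; apply/eqP; ring.
Qed.

(* The right-hand side is the value in the Euclidean plane. *)
Lemma two_sides_dist l k (x y z m n : M) : 0 <= l <= 1 -> 0 <= k <= 1 ->
  between l x y m -> between k x z n ->
  mdist m n ^+ 2 <= (l * mdist x y - k * mdist x z) ^+ 2 +
    l * k * (mdist y z ^+ 2 - (mdist x y - mdist x z) ^+ 2).
Proof.
move=> l01 k01 bm bn; have /andP[k0 k1] := k01.
have := between_cn m k01 bn; have := ler_wpM2l k0 (between_cn z l01 bm).
case: bm => xm _; rewrite !(metric_sym z) (metric_sym m x) xm; lra.
Qed.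

(** With equal ratios the differences of the two sides cancel in [two_sides_dist]. *)
Lemma between_convex_fan l (x y z m n : M) : 0 <= l <= 1 ->
  between l x y m -> between l x z n -> mdist m n <= l * mdist y z.
Proof.
move=> l01 bm bn; have /andP[l0 _] := l01.
rewrite -(@ler_pXn2r _ 2) ?nnegrE ?mdist_ge0 ?mulr_ge0 ?mdist_ge0 //.
apply: le_trans (two_sides_dist l01 l01 bm bn) _.
by rewrite le_eqVlt; apply/orP; left; apply/eqP; ring.
Qed.

(** The diagonal from [x] to [y'] cuts the quadrilateral into two fans. *)
Lemma between_convex l (x y x' y' m m' : M) : 0 <= l <= 1 ->
  between l x y m -> between l x' y' m' ->
  mdist m m' <= (1 - l) * mdist x x' + l * mdist y y'.
Proof.
move=> l01 bm bm'; have [n bn] := between_exists x y' l01.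
have l01' : 0 <= 1 - l <= 1 by case/andP: l01 => *; apply/andP; split; lra.
have h1 := between_convex_fan l01 bm bn.
have h2 := between_convex_fan l01' (between_sym bn) (between_sym bm').
have := metric_triangle m n m'; lra.
Qed.

(** Apply [between_cn] from [y] and from [w] to the midpoint of the diagonal [x z], through which
    the other diagonal is bounded. *)
Lemma quadrilateral (x y z w : M) :
  mdist x z ^+ 2 + mdist y w ^+ 2 <=
  mdist x y ^+ 2 + mdist y z ^+ 2 + mdist z w ^+ 2 + mdist w x ^+ 2.
Proof.
have h2 : 0 <= (2^-1 : R) <= 1 by apply/andP; split; lra.
have [m bm] := between_exists x z h2.
have := between_cn y h2 bm; have := between_cn w h2 bm.
have := metric_triangle y m w; have := mdist_ge0 y w.
rewrite (metric_sym m w) (metric_sym y x) (metric_sym w z).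
set a := mdist y m; set b := mdist w m => h0 tr h3 h4.
have : mdist y w ^+ 2 <= (a + b) ^+ 2.
  by rewrite ler_pXn2r ?nnegrE ?addr_ge0 ?mdist_ge0.
have := sqr_ge0 (a - b); lra.
Qed.

End ComparisonInequality.

(** * Convex functions of a real variable and elementary estimates *)

Section RealFunctions.
Context {R : realType}.

(** A rise from [x] to [y] continues at least linearly by convexity, and so overshoots any bound. *)
Lemma convex_bounded_nonincreasing (f : R -> R) K :
  (forall x y l, 0 <= x -> 0 <= y -> 0 <= l <= 1 ->
     f ((1 - l) * x + l * y) <= (1 - l) * f x + l * f y) ->
  (forall x, 0 <= x -> f x <= K) ->
  forall x y, 0 <= x -> x <= y -> f y <= f x.
Proof.
move=> fc fK x y x0 xy; rewrite leNgt; apply/negP => lt_f.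
have d0 : 0 < f y - f x by rewrite subr_gt0.
(* The chord extended [N] times rises by [|K - f x| + (f y - f x)], past [K]. *)
pose N := `|K - f x| / (f y - f x) + 1.
have N1 : 1 <= N by rewrite lerDr divr_ge0 ?normr_ge0 // ltW.
have N0 : 0 < N by exact: lt_le_trans N1.
have z0 : 0 <= x + N * (y - x) by rewrite addr_ge0 // mulr_ge0 ?subr_ge0 // ltW.
have l01 : 0 <= N^-1 <= 1 by rewrite invr_ge0 ltW //= invf_le1.
have := fc _ _ _ x0 z0 l01; have := fK _ z0.
have -> : (1 - N^-1) * x + N^-1 * (x + N * (y - x)) = y.
  by field; rewrite gt_eqF.
set F := f (x + _) => FK h.
have : N * f y <= N * ((1 - N^-1) * f x + N^-1 * F) by rewrite ler_pM2l.
have -> : N * ((1 - N^-1) * f x + N^-1 * F) = (N - 1) * f x + F.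
  by field; rewrite gt_eqF.
have : N * (f y - f x) = `|K - f x| + (f y - f x).
  by rewrite /N mulrDl mul1r divfK // gt_eqF.
have := ler_norm (K - f x); lra.
Qed.

Lemma convex_bounded_constant (f : R -> R) K :
  (forall x y l, 0 <= l <= 1 ->
     f ((1 - l) * x + l * y) <= (1 - l) * f x + l * f y) ->
  (forall x, f x <= K) -> forall x y, f x = f y.
Proof.
move=> fc fK; suff H x y : f y <= f x.
  by move=> x y; apply/eqP; rewrite eq_le !H.
have [xy|yx] := leP x y.
- have := @convex_bounded_nonincreasing (fun t => f (x + t)) K _ _ 0 (y - x).
  rewrite addr0 subrKC lexx subr_ge0; apply => // a b l _ _ l01.
  by apply: le_trans (fc _ _ _ l01); rewrite le_eqVlt; apply/orP; left;
    apply/eqP; congr f; ring.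
- have := @convex_bounded_nonincreasing (fun t => f (x - t)) K _ _ 0 (x - y).
  rewrite subr0 subKr lexx subr_ge0 (ltW yx); apply => // a b l _ _ l01.
  by apply: le_trans (fc _ _ _ l01); rewrite le_eqVlt; apply/orP; left;
    apply/eqP; congr f; ring.
Qed.

(** Midpoint convexity and the second hypothesis give [f (- x) = 2 * f 0 - f x]; convexity at [x]
    and at [- x] then yields opposite inequalities, so [f - f 0] is homogeneous. *)
Lemma convex_concave_affine (f : R -> R) :
  (forall x y l, 0 <= l <= 1 ->
     f ((1 - l) * x + l * y) <= (1 - l) * f x + l * f y) ->
  (forall x, f x + f (- x) <= 2 * f 0) ->
  exists k, forall x, f x = k * x + f 0.
Proof.
move=> fc f2.
have odd x : f (- x) = 2 * f 0 - f x.
  have h2 : 0 <= (2^-1 : R) <= 1 by apply/andP; split; lra.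
  have := fc x (- x) _ h2; have := f2 x.
  have -> : (1 - 2^-1) * x + 2^-1 * - x = 0 by field.
  lra.
have star x l : 0 <= l <= 1 -> f (l * x) <= (1 - l) * f 0 + l * f x.
  by move=> l01; have := fc 0 x l l01; rewrite mulr0 add0r.
have hom x l : 0 <= l <= 1 -> f (l * x) - f 0 = l * (f x - f 0).
  move=> l01; have := star x l l01; have := star (- x) l l01.
  rewrite mulrN !odd; lra.
have pos x : 0 <= x -> f x = (f 1 - f 0) * x + f 0.
  move=> x0; have [x1|x1] := leP x 1.
    have := hom 1 x; rewrite x0 x1 mulr1 => /(_ isT); lra.
  have x_gt0 : 0 < x by exact: lt_trans x1.
  have := hom x x^-1; rewrite invr_ge0 x0 invf_le1 // (ltW x1) => /(_ isT).
  rewrite mulVf ?gt_eqF // => -> ; field; by rewrite gt_eqF.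
exists (f 1 - f 0) => x; have [x0|x0] := leP 0 x; first exact: pos.
have := pos (- x); rewrite odd oppr_ge0 (ltW x0) => /(_ isT); lra.
Qed.

(** The square root of [y ^ 2 + E] minus [y] tends to 0: a bounded transverse displacement costs
    arbitrarily little at large distance. *)
Lemma sqr_le_add_eps (E e : R) : 0 < e -> exists2 Y, 0 < Y &
  forall x y, Y <= y -> x ^+ 2 <= y ^+ 2 + E -> x <= y + e.
Proof.
move=> e0; exists (`|E| / e + 1); first by rewrite ltr_wpDl // divr_ge0 // ltW.
move=> x y Yy xy; rewrite leNgt; apply/negP => lt_x.
have y0 : 0 < y by apply: lt_le_trans Yy; rewrite ltr_wpDl // divr_ge0 // ltW.
have : (y + e) ^+ 2 < x ^+ 2.
  rewrite ltr_pXn2r ?nnegrE //; first by rewrite addr_ge0 // ltW.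
  by apply: ltW; apply: lt_trans lt_x; rewrite addr_gt0.
have : e * (`|E| / e + 1) <= e * y by rewrite ler_pM2l.
rewrite mulrDr mulr1 mulrC divfK ?gt_eqF //.
have := ler_norm E; have := normr_ge0 E; nra.
Qed.

Lemma exists_natr_gt (x : R) : exists n : nat, x < n%:R.
Proof.
exists (Num.bound `|x|); apply: le_lt_trans (ler_norm x) _.
by apply: archi_boundP; exact: normr_ge0.
Qed.

End RealFunctions.

(** * Limits of sequences in a complete space *)

Section Limits.
Context {R : realType} {M : completeMetricType R}.

Definition tends (u : nat -> M) (x : M) : Prop :=
  forall e, 0 < e -> exists N, forall n, (N <= n)%N -> mdist (u n) x <= e.

Lemma cauchy_tends (u : nat -> M) :
  (forall e, 0 < e -> exists N, forall j k, (N <= j)%N -> (N <= k)%N ->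
     mdist (u j) (u k) <= e) ->
  exists x, tends u x.
Proof.
move=> cu; have : cvg (u @ \oo).
  apply: cauchy_cvg; apply: cauchy_exP => e e0.
  have [N NP] := cu (e / 2) ltac:(by rewrite divr_gt0).
  exists (u N); exists N => // n /= Nn; rewrite ballEmdist /=.
  by apply: le_lt_trans (NP N n (leqnn N) Nn) _; lra.
move=> /metricType_numDomainType.cvgr_dist_le h; exists (lim (u @ \oo)) => e e0.
have [N _ NP] := h e e0; exists N => n Nn; rewrite metric_sym; exact: NP.
Qed.

Lemma tends_cst x : tends (fun=> x) x.
Proof. by move=> e e0; exists 0%N => n _; rewrite mdistxx ltW. Qed.

Lemma tends_dist_le u v x y K : tends u x -> tends v y ->
  (exists N, forall n, (N <= n)%N -> mdist (u n) (v n) <= K) -> mdist x y <= K.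
Proof.
move=> ux vy [N NP]; apply/ler_addgt0Pl => e e0.
have e2 : 0 < e / 2 by rewrite divr_gt0.
have [N1 P1] := ux _ e2; have [N2 P2] := vy _ e2.
pose n := maxn N (maxn N1 N2).
have h1 := P1 n ltac:(by rewrite /n; lia).
have h2 := P2 n ltac:(by rewrite /n; lia).
have h3 := NP n ltac:(by rewrite /n; lia).
have := metric_triangle x (u n) y; have := metric_triangle (u n) (v n) y.
rewrite (metric_sym x (u n)); lra.
Qed.

Lemma tends_dist_ge u v x y K : tends u x -> tends v y ->
  (exists N, forall n, (N <= n)%N -> K <= mdist (u n) (v n)) -> K <= mdist x y.
Proof.
move=> ux vy [N NP]; apply/ler_addgt0Pl => e e0.
have e2 : 0 < e / 2 by rewrite divr_gt0.
have [N1 P1] := ux _ e2; have [N2 P2] := vy _ e2.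
pose n := maxn N (maxn N1 N2).
have h1 := P1 n ltac:(by rewrite /n; lia).
have h2 := P2 n ltac:(by rewrite /n; lia).
have h3 := NP n ltac:(by rewrite /n; lia).
have := metric_triangle (u n) x (v n); have := metric_triangle x y (v n).
rewrite (metric_sym y (v n)); lra.
Qed.

End Limits.

(** * Parallel lines and flat strips *)

Section ParallelLines.
Context {R : realType} {M : metricType R}.
Hypothesis catM : CAT0 M.
Implicit Types c : R -> M.

Definition parallel c c' : Prop := exists K, forall t, mdist (c t) (c' t) <= K.

(* Facing points of the flat strip between [c] and [c'] have equal parameters. *)
Definition synchronized c c' : Prop := forall t s,
  mdist (c t) (c' s) ^+ 2 = (s - t) ^+ 2 + mdist (c 0) (c' 0) ^+ 2.

Lemma line_dist c s t : geodesic_line c -> mdist (c s) (c t) = `|s - t|.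
Proof. by apply. Qed.

Lemma line_between c l x y : geodesic_line c -> 0 <= l <= 1 ->
  between l (c x) (c y) (c ((1 - l) * x + l * y)).
Proof.
move=> gc /andP[l0 l1]; split; rewrite !(line_dist _ _ gc).
- rewrite (_ : x - _ = l * (x - y)); last by ring.
  by rewrite normrM ger0_norm.
- rewrite (_ : _ - y = (1 - l) * (x - y)); last by ring.
  by rewrite normrM (@ger0_norm _ (1 - l)) // subr_ge0.
Qed.

Lemma line_shift c a : geodesic_line c -> geodesic_line (fun t => c (t + a)).
Proof.
by move=> gc s t _ _; rewrite line_dist // opprD addrACA subrr addr0.
Qed.

(** As a function of [t] this distance is convex and bounded on the whole real line, hence
    constant. *)
Lemma parallel_dist_shift c c' s t : geodesic_line c -> geodesic_line c' ->
  parallel c c' -> mdist (c t) (c' (t + s)) = mdist (c 0) (c' s).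
Proof.
move=> gc gc' [K cK].
rewrite (@convex_bounded_constant _ (fun t => mdist (c t) (c' (t + s)))
  (K + `|s|) _ _ t 0) ?add0r // => [x y l l01|x].
- have := between_convex catM l01 (line_between x y gc l01)
    (line_between (x + s) (y + s) gc' l01).
  by rewrite (_ : (1 - l) * (x + s) + _ = (1 - l) * x + l * y + s) //; ring.
- have := metric_triangle (c x) (c' x) (c' (x + s)).
  rewrite (line_dist _ _ gc') opprD addrA subrr add0r normrN.
  by have := cK x; lra.
Qed.

(* With [f s] the distance from [c 0] to [c' s], the function [f s ^+ 2 - s ^+ 2]
   is convex by the CAT(0) inequality and midpoint concave by the quadrilateral
   inequality, hence affine. *)
Lemma flat_strip c c' : geodesic_line c -> geodesic_line c' -> parallel c c' ->
  exists k, forall t s, mdist (c t) (c' s) ^+ 2 =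
    (s - t) ^+ 2 + k * (s - t) + mdist (c 0) (c' 0) ^+ 2.
Proof.
move=> gc gc' pcc'; have dE := parallel_dist_shift _ _ gc gc' pcc'.
pose f s := mdist (c 0) (c' s) ^+ 2 - s ^+ 2.
have [||k fk] := @convex_concave_affine _ f.
- move=> x y l l01; rewrite /f.
  have := between_cn catM (c 0) l01 (line_between x y gc' l01).
  rewrite (line_dist _ _ gc') real_normK ?num_real //; lra.
- move=> x; rewrite /f.
  (* The diagonals have lengths [d(c 0, c' x)] and, after a shift, [d(c 0, c' (- x))]; the sides are
     [|x|] and [d(c 0, c' 0)], twice each. *)
  have := quadrilateral catM (c 0) (c x) (c' x) (c' 0).
  rewrite (line_dist _ _ gc) (line_dist _ _ gc') !real_normK ?num_real //.
  rewrite (metric_sym (c' 0)).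
  have := dE 0 x; have := dE (- x) x; rewrite subrr addr0 => -> ->; lra.
exists k => t s; have := dE (s - t) t; rewrite subrKC => ->.
have := fk (s - t); rewrite /f; lra.
Qed.

Lemma synchronized_diag c c' t : synchronized c c' ->
  mdist (c t) (c' t) = mdist (c 0) (c' 0).
Proof.
move=> h; apply/eqP; rewrite -(@eqrXn2 _ 2) ?mdist_ge0 // h subrr expr0n add0r.
exact: eqxx.
Qed.

Lemma synchronized_parallel c c' : synchronized c c' -> parallel c c'.
Proof.
by move=> h; exists (mdist (c 0) (c' 0)) => t; rewrite synchronized_diag.
Qed.

Lemma synchronized_min c c' t s : synchronized c c' ->
  mdist (c 0) (c' 0) <= mdist (c t) (c' s).
Proof.
move=> h; rewrite -(@ler_pXn2r _ 2) ?nnegrE ?mdist_ge0 // (h t s).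
by rewrite lerDr sqr_ge0.
Qed.

Lemma synchronized_reverse c c' : synchronized c c' ->
  synchronized (fun t => c (- t)) (fun t => c' (- t)).
Proof. by move=> h t s /=; rewrite h oppr0 -opprD sqrrN. Qed.

Lemma parallel_sym c c' : parallel c c' -> parallel c' c.
Proof. by move=> [K h]; exists K => t; rewrite metric_sym. Qed.

Lemma parallel_trans c2 c1 c3 :
  parallel c1 c2 -> parallel c2 c3 -> parallel c1 c3.
Proof.
move=> [K h] [K' h']; exists (K + K') => t.
by apply: le_trans (metric_triangle _ (c2 t) _) _; exact: lerD.
Qed.

Lemma parallel_synchronize c c' : geodesic_line c -> geodesic_line c' ->
  parallel c c' -> exists a, synchronized c (fun s => c' (s + a)).
Proof.
move=> gc gc' pcc'; have [k h] := flat_strip gc gc' pcc'.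
(* This shift completes the square in [flat_strip]. *)
by exists (- (k / 2)) => t s; rewrite (h t) (h 0 (0 + _)); field.
Qed.

(** The detour through [c s] has two legs, each of squared length [s ^ 2] plus a constant, hence of
    length at most [s + e] for large [s]. *)
Lemma synchronized_composite_bound c c1 c2 e : 0 < e ->
  synchronized c c1 -> synchronized c c2 ->
  exists Y, forall s, Y <= s -> mdist (c1 0) (c2 (s + s)) <= s + s + (e + e).
Proof.
move=> e0 h1 h2.
have [Y1 _ P1] := sqr_le_add_eps (mdist (c 0) (c1 0) ^+ 2) e0.
have [Y2 _ P2] := sqr_le_add_eps (mdist (c 0) (c2 0) ^+ 2) e0.
exists (Num.max Y1 Y2) => s; rewrite ge_max => /andP[s1 s2].
have d1 : mdist (c1 0) (c s) <= s + e.
  by apply: P1 => //; rewrite metric_sym (h1 s 0) sub0r sqrrN.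
have d2 : mdist (c s) (c2 (s + s)) <= s + e.
  by apply: P2 => //; rewrite (h2 s (s + s)) addrK.
have := metric_triangle (c1 0) (c s) (c2 (s + s)); lra.
Qed.

(** By [flat_strip] the only obstruction is a linear term of slope [k]. Detours through [c] show
    [k <= 0], and the reversed lines give [- k <= 0]. This transitivity makes the parallel set a
    product. *)
Lemma synchronized_trans c c1 c2 : geodesic_line c1 -> geodesic_line c2 ->
  synchronized c c1 -> synchronized c c2 -> synchronized c1 c2.
Proof.
move=> g1 g2 h1 h2; have [|k h] := flat_strip g1 g2.
  by apply: (@parallel_trans c); [apply: parallel_sym|];
    exact: synchronized_parallel.
(* [b1] is the orientation, [1] or [-1], so that one argument serves both signs. *)
have slope_le0 b1 b2 k' :
    synchronized (fun t => c (b1 * t)) (fun t => c1 (b1 * t)) ->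
    synchronized (fun t => c (b1 * t)) (fun t => c2 (b1 * t)) ->
    (forall s, mdist (c1 (b1 * 0)) (c2 (b1 * s)) ^+ 2 =
       s ^+ 2 + k' * s + b2 ^+ 2) ->
    k' <= 0.
  move=> s1 s2 hk; rewrite leNgt; apply/negP => k0.
  (* At parameter [2 * s] the squared distance exceeds [4 * s ^ 2] by at least [2 * k' * s], while
     the detour allows only [2 * k' * s / 3 + k' ^ 2 / 36]: too little once [s >= k']. *)
  have e0 : 0 < k' / 12 by rewrite divr_gt0.
  have [Y YP] := synchronized_composite_bound e0 s1 s2.
  pose s := Num.max Y k'.
  have Ys : Y <= s by rewrite le_max lexx.
  have ks : k' <= s by rewrite le_max lexx orbT.
  have s0 : 0 < s by exact: lt_le_trans ks.
  have := YP s Ys; rewrite -(@ler_pXn2r _ 2) ?nnegrE ?mdist_ge0 //; last first.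
    by rewrite !addr_ge0 ?ltW.
  rewrite hk; have := sqr_ge0 b2; nra.
have k0 : k = 0.
  apply/eqP; rewrite eq_le; apply/andP; split.
  - apply: (slope_le0 1 (mdist (c1 0) (c2 0))) => [t s|t s|s];
      rewrite !mul1r //.
    by rewrite h !subr0.
  - rewrite -oppr_le0.
    apply: (slope_le0 (-1) (mdist (c1 0) (c2 0))) => [t s|t s|s].
    + by rewrite !mulN1r; exact: synchronized_reverse h1 t s.
    + by rewrite !mulN1r; exact: synchronized_reverse h2 t s.
    + by rewrite !mulN1r h oppr0 subr0 sqrrN mulrN mulNr.
by move=> t s; rewrite h k0 mul0r addr0.
Qed.

(** The points of [c1] at [a - N] and [a + N] are [2 * N] apart, and the path through [m t] and
    [m t'] is no shorter; for large [N] its outer legs exceed [N + t + u] and [N - t' - u] by at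
    most [e / 2]. *)
Lemma between_lines_lower_bound c1 c2 m l a b t t' :
  geodesic_line c1 -> synchronized c1 c2 -> 0 <= l <= 1 ->
  (forall t, between l (c1 (a + t)) (c2 (b + t)) (m t)) ->
  t' - t <= mdist (m t) (m t').
Proof.
move=> g1 h l01 bm; apply/ler_addgt0Pr => e e0.
have e2 : 0 < e / 2 by rewrite divr_gt0.
set D := mdist (c1 0) (c2 0).
have [Y Y0 YP] := sqr_le_add_eps (l ^+ 2 * D ^+ 2) e2.
(* In a flat strip [m s] would face the point of [c1] at parameter [a + s + u], at height
   [l * D]. *)
pose u := l * (b - a).
have key x s :
    mdist (c1 (a + x)) (m s) ^+ 2 <= (s + u - x) ^+ 2 + l ^+ 2 * D ^+ 2.
  have := between_cn catM (c1 (a + x)) l01 (bm s).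
  rewrite (line_dist _ _ g1) (h (a + x)) (h (a + s)).
  rewrite real_normK ?num_real // -/D /u; lra.
pose N := Y + `|t| + `|t'| + `|u|.
have bd x s y : Y <= y -> (s + u - x) ^+ 2 = y ^+ 2 ->
    mdist (c1 (a + x)) (m s) <= y + e / 2.
  by move=> Yy E; apply: YP => //; rewrite -E.
have := ler_norm t; have := ler_norm (- t); have := ler_norm t'.
have := ler_norm (- t'); have := ler_norm u; have := ler_norm (- u).
rewrite !normrN => *.
have := bd (- N) t (N + t + u) ltac:(by rewrite /N; lra) ltac:(by ring).
have := bd N t' (N - t' - u) ltac:(by rewrite /N; lra) ltac:(by ring).
have := metric_triangle (c1 (a - N)) (m t) (c1 (a + N)).
have := metric_triangle (m t) (m t') (c1 (a + N)).
rewrite (metric_sym (m t') (c1 _)) (line_dist _ _ g1).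
rewrite (_ : a - N - (a + N) = - (N + N)); last by ring.
rewrite normrN ger0_norm; last by rewrite /N; lra.
lra.
Qed.

Lemma between_lines_line c1 c2 m l a b :
  geodesic_line c1 -> geodesic_line c2 -> synchronized c1 c2 -> 0 <= l <= 1 ->
  (forall t, between l (c1 (a + t)) (c2 (b + t)) (m t)) -> geodesic_line m.
Proof.
move=> g1 g2 h l01 bm s t _ _; apply/eqP; rewrite eq_le; apply/andP; split.
  have := between_convex catM l01 (bm s) (bm t).
  rewrite (line_dist _ _ g1) (line_dist _ _ g2).
  rewrite (_ : a + s - _ = s - t); last by ring.
  rewrite (_ : b + s - _ = s - t); last by ring.
  lra.
have h1 := between_lines_lower_bound s t g1 h l01 bm.
have h2 := between_lines_lower_bound t s g1 h l01 bm.
by rewrite metric_sym in h2; rewrite ler_norml; apply/andP; split; lra.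
Qed.

Lemma between_lines_parallel c1 c2 m l a b :
  geodesic_line c1 -> geodesic_line c2 -> synchronized c1 c2 -> 0 <= l <= 1 ->
  (forall t, between l (c1 (a + t)) (c2 (b + t)) (m t)) -> parallel c1 m.
Proof.
move=> g1 g2 h l01 bm; exists (`|a| + (mdist (c1 0) (c2 0) + `|a - b|)) => t.
have := metric_triangle (c1 t) (c1 (a + t)) (m t).
rewrite (line_dist _ _ g1) (_ : t - _ = - a); last by ring.
rewrite normrN (bm t).1.
have := metric_triangle (c1 (a + t)) (c2 (a + t)) (c2 (b + t)).
rewrite (synchronized_diag _ h) (line_dist _ _ g2).
rewrite (_ : a + t - _ = a - b); last by ring.
have : l * mdist (c1 (a + t)) (c2 (b + t)) <= mdist (c1 (a + t)) (c2 (b + t)).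
  by rewrite ler_piMl ?mdist_ge0 //; case/andP: l01.
lra.
Qed.

End ParallelLines.

(** * Circumcenters of bounded spaces *)

Section BoundedFixedPoint.
Context {R : realType} {T : Type} (d : T -> T -> R).
Hypothesis d_ge0 : forall x y, 0 <= d x y.
Hypothesis d_sym : forall x y, d x y = d y x.
Hypothesis d_triangle : forall y x z, d x z <= d x y + d y z.
Hypothesis d_midpoint : forall x y, exists m, forall z,
  d z m ^+ 2 <= (d z x ^+ 2 + d z y ^+ 2) / 2 - d x y ^+ 2 / 4.
Hypothesis d_complete : forall u : nat -> T,
  (forall e : R, 0 < e -> exists N, forall j k, (N <= j)%N -> (N <= k)%N ->
     d (u j) (u k) <= e) ->
  exists x, forall e : R, 0 < e ->
    exists N, forall n, (N <= n)%N -> d (u n) x <= e.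

Let encloses x s := forall z, d z x <= s.
Let radii : set R := [set s | exists x, encloses x s].
Let radius := inf radii.

Let radii_lbound : lbound radii 0.
Proof. by move=> s [x xs]; exact: le_trans (d_ge0 x x) (xs x). Qed.

(** The midpoint of [x] and [y] encloses with squared radius [s ^ 2 - d x y ^ 2 / 4], which cannot
    be below [radius ^ 2]. *)
Let enclosing_close x y s : encloses x s -> encloses y s ->
  d x y ^+ 2 <= 4 * (s ^+ 2 - radius ^+ 2).
Proof.
move=> xs ys; have [m mP] := d_midpoint x y.
have q z : d z m ^+ 2 <= s ^+ 2 - d x y ^+ 2 / 4.
  have : d z x ^+ 2 <= s ^+ 2.
    by rewrite ler_pXn2r ?nnegrE // (le_trans _ (xs z)).
  have : d z y ^+ 2 <= s ^+ 2.
    by rewrite ler_pXn2r ?nnegrE // (le_trans _ (xs z)).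
  have := mP z; lra.
have q0 : 0 <= s ^+ 2 - d x y ^+ 2 / 4 by exact: le_trans (sqr_ge0 _) (q m).
have : radius <= Num.sqrt (s ^+ 2 - d x y ^+ 2 / 4).
  apply: ge_inf; first by exists 0.
  by exists m => z; rewrite -(ger0_norm (d_ge0 z m)) -sqrtr_sqr ler_sqrt.
have r0 : 0 <= radius by apply: lb_le_inf => //; exists s, x.
rewrite -(@ler_pXn2r _ 2) ?nnegrE ?sqrtr_ge0 // sqr_sqrtr //; lra.
Qed.

(* The circumcenter is the unique center of an enclosing ball of least radius. *)
Lemma bounded_isometry_fixed_point (h : T -> T) (t0 : T) K :
  (forall x y, d x y <= K) ->
  (forall x y, d (h x) (h y) = d x y) -> (forall z, exists y, d (h y) z = 0) ->
  exists x, d (h x) x = 0.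
Proof.
move=> dK hd hsurj.
have has_inf_radii : has_inf radii.
  by split; [exists K, t0 => z | exists 0].
have r0 : 0 <= radius by apply: lb_le_inf => //; case: has_inf_radii.
have ex n : exists x, encloses x (radius + n.+1%:R^-1).
  have [||s [x xs] lt_s] := @inf_adherent _ radii n.+1%:R^-1 _ _ => //.
  by exists x => z; apply: le_trans (xs z) (ltW _).
have [u uP] := choice ex.
have small (e : R) : 0 < e ->
    exists N : nat, forall n, (N <= n)%N -> n.+1%:R^-1 <= e.
  move=> e0; have [N NP] := exists_natr_gt e^-1; exists N => n Nn.
  rewrite -(invrK e) lef_pV2 ?posrE ?invr_gt0 //.
  by apply: le_trans (ltW NP) _; rewrite ler_nat; lia.
have [|x ux] := d_complete (u := u).
  (* Chosen so that [4 * ((radius + eta) ^ 2 - radius ^ 2) <= e ^ 2], the bound of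
     [enclosing_close]. *)
  move=> e e0; pose eta := Num.min 1 (e ^+ 2 / (4 * (2 * radius + 1))).
  have D0 : 0 < 4 * (2 * radius + 1).
    by rewrite mulr_gt0 // ltr_wpDl // mulr_ge0.
  have eta0 : 0 < eta by rewrite lt_min ltr01 divr_gt0 // exprn_gt0.
  have eta1 : eta <= 1 by rewrite ge_min lexx.
  have etae : eta * (4 * (2 * radius + 1)) <= e ^+ 2.
    by rewrite -ler_pdivlMr // ge_min lexx orbT.
  have [N NP] := small _ eta0; exists N => j k Nj Nk.
  have enc n : (N <= n)%N -> encloses (u n) (radius + eta).
    by move=> Nn z; apply: le_trans (uP n z) _; rewrite lerD2l NP.
  rewrite -(@ler_pXn2r _ 2) ?nnegrE // ?(ltW e0) //.
  apply: le_trans (enclosing_close (enc j Nj) (enc k Nk)) _.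
  nra.
have xr : encloses x radius.
  move=> z; apply/ler_addgt0Pr => e e0.
  have e2 : 0 < e / 2 by rewrite divr_gt0.
  have [N NP] := small _ e2; have [N' NP'] := ux _ e2.
  pose n := maxn N N'.
  have := NP n (leq_maxl _ _); have := NP' n (leq_maxr _ _).
  have := d_triangle (u n) z x; have := uP n z; set r := n.+1%:R^-1.
  move=> *; lra.
(* Every point is at distance 0 from some [h y], so [h x] encloses as tightly as [x]. *)
have hxr : encloses (h x) radius.
  move=> z; have [y yz] := hsurj z; apply: le_trans (d_triangle (h y) _ _) _.
  by rewrite d_sym yz add0r hd.
exists x; apply/eqP; rewrite -sqrf_eq0 eq_le sqr_ge0 andbT.
by have := enclosing_close hxr xr; rewrite subrr mulr0.
Qed.

End BoundedFixedPoint.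


(** * Metric induced by an injection *)

Section Pullback.
Context {R : realType} {M : metricType R} (T : choiceType) (h : T -> M).
(** The alias carries the proof of injectivity, which supplies the separation axiom of the induced
    metric. *)
Definition pullback of injective h : Type := T.
Variable h_inj : injective h.
Let pullback_dist (x y : pullback h_inj) : R := mdist (h x) (h y).
Let pullback_dist_positivity x y : pullback_dist x y = 0 -> x = y.
Proof. by move/mdist_positivity/h_inj. Qed.

HB.instance Definition _ := Choice.on (pullback h_inj).
HB.instance Definition _ := isMetric.Build R (pullback h_inj)
  (fun x => mdistxx (h x)) pullback_dist_positivity
  (fun x y => metric_sym (h x) (h y))
  (fun x y z => metric_triangle (h y) (h x) (h z)).
End Pullback.

(** * Product structure of the parallel set and invariant lines *)

Section ParallelSet.
Context {R : realType} {M : completeMetricType R}.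
Hypothesis catM : CAT0 M.
Variable c0 : R -> M.
Hypothesis line_c0 : geodesic_line c0.
Implicit Types c : R -> M.

(** This is the factor [U] of the product: synchronization selects one parametrization of each line
    parallel to [c0], and distances in [U] are read at parameter 0. *)
Definition synchronized_lines : set (R -> M) :=
  [set c | geodesic_line c /\ synchronized c0 c].

Definition parallel_set : set M :=
  [set x | exists c t, synchronized_lines c /\ x = c t].

Let L := synchronized_lines.

Let synchronized_linesP c1 c2 : L c1 -> L c2 -> synchronized c1 c2.
Proof.
by move=> [g1 h1] [g2 h2]; exact: (synchronized_trans catM g1 g2 h1 h2).
Qed.

Lemma parallel_synchronized c : geodesic_line c -> parallel c0 c ->
  exists a, L (fun t => c (t + a)).
Proof.
move=> gc pc; have [a h] := parallel_synchronize catM line_c0 gc pc.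
by exists a; split=> //; exact: line_shift.
Qed.

(** The pointwise interpolation of two lines is a line parallel to [c0]; an unspecified shift [k]
    synchronizes it. *)
Lemma between_synchronized c1 c2 (l a b : R) : L c1 -> L c2 -> 0 <= l <= 1 ->
  exists m k, L (fun t => m (t + k)) /\
    forall t, between l (c1 (a + t)) (c2 (b + t)) (m t).
Proof.
move=> L1 L2 l01; have s12 := synchronized_linesP L1 L2.
have [m bm] :=
  choice (fun t => between_exists catM (c1 (a + t)) (c2 (b + t)) l01).
have gm := between_lines_line catM L1.1 L2.1 s12 l01 bm.
have pm := between_lines_parallel L1.1 L2.1 s12 l01 bm.
have [k Lk] := parallel_synchronized gm
  (parallel_trans (synchronized_parallel L1.2) pm).
by exists m, k.
Qed.

Lemma parallel_set_convex : convex_subset parallel_set.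
Proof.
move=> _ _ [c1 [a [L1 ->]]] [c2 [b [L2 ->]]]; split; first exact: CAT0_segment.
move=> c gc z [s sD <-]; move: sD => /=; rewrite in_itv /= => /andP[s0 sD].
set D := mdist (c1 a) (c2 b) in sD.
have [l l01 sE] : exists2 l : R, 0 <= l <= 1 & s = l * D.
  have [D0|D0] := eqVneq D 0.
    exists 0; rewrite ?lexx ?ler01 // mul0r.
    by apply/eqP; rewrite eq_le s0 -D0 sD.
  have Dgt0 : 0 < D by rewrite lt_neqAle eq_sym D0 mdist_ge0.
  exists (s / D); last by rewrite divfK.
  by rewrite divr_ge0 ?mdist_ge0 //= ler_pdivrMr // mul1r.
have [m [k [Lm bm]]] := between_synchronized a b L1 L2 l01.
exists (fun t => m (t + k)), (- k); split => //.
rewrite addNr; have := bm 0; rewrite !addr0 => bm0.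
by rewrite sE; apply: (between_unique catM l01 _ bm0); exact: segment_between.
Qed.

Let crossing (u : set_type L) : M := sval u 0.

Let crossing_inj : injective crossing.
Proof.
move=> [c1 L1] [c2 L2] /= E; apply: val_inj => /=; apply/funext => t.
apply: mdist_positivity; rewrite (@synchronized_diag _ _ _ _ t).
  by rewrite [X in mdist X _]E mdistxx.
by apply: synchronized_linesP; rewrite -in_setE.
Qed.

(** By synchronization, evaluation of a line at a parameter is an isometry from the product onto the
    parallel set, which would be an infinite flat strip if the factor were unbounded. *)
Lemma synchronized_lines_bounded : ~ has_infinite_flat_strip M ->
  exists K, forall c1 c2, L c1 -> L c2 -> mdist (c1 0) (c2 0) <= K.
Proof.
move=> noflat; apply: contrapT => unb; apply: noflat.
exists parallel_set, (pullback crossing_inj).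
exists (fun p => sval (p.1 : set_type L) p.2); split.
- exact: parallel_set_convex.
- move=> [K KP]; apply: unb; exists K => c1 c2 L1 L2.
  exact: (KP (exist _ c1 (mem_set L1) : set_type L)
             (exist _ c2 (mem_set L2) : set_type L)).
- move=> [[c1 L1] t] [[c2 L2] s] /=.
  rewrite -[LHS]ger0_norm ?mdist_ge0 // -sqrtr_sqr [RHS]/mdist /= /l2dist /=.
  rewrite (synchronized_linesP (set_mem L1) (set_mem L2)) addrC.
  by rewrite [in RHS]/mdist /= real_normK ?num_real.
- apply/seteqP; split => [_ [[[c Lc] t] _ <-] /=|_ [c [t [Lc ->]]]].
    by exists c, t; split => //; exact: set_mem.
  by exists ((exist _ c (mem_set Lc) : set_type L), t).
Qed.

Lemma synchronized_lines_complete (u : nat -> R -> M) : (forall n, L (u n)) ->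
  (forall e : R, 0 < e -> exists N, forall j k, (N <= j)%N -> (N <= k)%N ->
     mdist (u j 0) (u k 0) <= e) ->
  exists2 c, L c & tends (u^~ 0) (c 0).
Proof.
move=> Lu cu.
have lim t : exists x, tends (u^~ t) x.
  apply: cauchy_tends => e /cu[N NP]; exists N => j k Nj Nk.
  by rewrite (synchronized_diag _ (synchronized_linesP (Lu j) (Lu k))) NP.
have [c cP] := choice lim.
have gc : geodesic_line c.
  move=> s t _ _; apply/eqP; rewrite eq_le; apply/andP; split.
    apply: (tends_dist_le (cP s) (cP t)); exists 0%N => n _.
    by rewrite (line_dist _ _ (Lu n).1).
  apply: (tends_dist_ge (cP s) (cP t)); exists 0%N => n _.
  by rewrite (line_dist _ _ (Lu n).1).
have pc : parallel c0 c.
  have [N NP] := cP 0 1 ltr01; exists (mdist (c0 0) (c 0) + 1) => t.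
  apply: (tends_dist_le (tends_cst (c0 t)) (cP t)); exists N => n Nn.
  rewrite (synchronized_diag _ (Lu n).2); have := NP n Nn.
  have := metric_triangle (c0 0) (c 0) (u n 0).
  rewrite (metric_sym (c 0)); lra.
(* The pointwise limit is put in [L] by a shift, which does not increase distances to the [u n 0],
   since those at equal parameters are the least. *)
have [a La] := parallel_synchronized gc pc.
exists (fun t => c (t + a)) => // e e0; have [N NP] := cP 0 e e0.
exists N => n Nn; apply: le_trans (NP n Nn).
have := synchronized_min 0 (- a) (synchronized_linesP (Lu n) La).
by rewrite addNr.
Qed.

Let isometry_synchronized g c :
  distance_preserving g -> parallel c0 (g \o c0) ->
  geodesic_line c -> parallel c0 c -> exists a, L (fun t => g (c (t + a))).
Proof.
move=> gd [K pg] gc [K' pc].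
apply: (@parallel_synchronized (g \o c)).
  by move=> s t Ds Dt; rewrite /= gd gc.
exists (K + K') => t /=; apply: le_trans (metric_triangle _ (g (c0 t)) _) _.
by rewrite lerD // gd.
Qed.

(** The distance at equal parameters is the least distance between synchronized lines, so it is
    insensitive to the shifts: [g] acts isometrically on the factor. *)
Let isometry_shift_dist g c1 c2 a1 a2 : distance_preserving g -> L c1 -> L c2 ->
  L (fun t => g (c1 (t + a1))) -> L (fun t => g (c2 (t + a2))) ->
  mdist (g (c1 (0 + a1))) (g (c2 (0 + a2))) = mdist (c1 0) (c2 0).
Proof.
move=> gd L1 L2 L1' L2'; apply/eqP; rewrite eq_le; apply/andP; split.
- have := synchronized_min (- a1) (- a2) (synchronized_linesP L1' L2').
  by rewrite !addNr !gd.
- by rewrite gd; exact: synchronized_min (synchronized_linesP L1 L2).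
Qed.

(** [h] is the action of [g] on the bounded factor; its fixed point is a line that [g] carries to
    itself up to a shift. *)
Lemma invariant_parallel_line (g : M -> M) : metric_isometry g ->
  ~ has_infinite_flat_strip M -> parallel c0 (g \o c0) ->
  exists c a, geodesic_line c /\ forall t, g (c t) = c (t + a).
Proof.
move=> [[g' gK g'K] gd] noflat pg.
have g'd : distance_preserving g' by move=> x y; rewrite -gd !g'K.
have pg' : parallel c0 (g' \o c0).
  by case: pg => K pg; exists K => t; rewrite /= -gd g'K metric_sym.
have Lp c : L c -> geodesic_line c /\ parallel c0 c.
  by case=> gc hc; split=> //; exact: synchronized_parallel.
have ex (u : set_type L) : exists a, L (fun t => g (sval u (t + a))).
  by have [gu pu] := Lp _ (set_valP u); exact: isometry_synchronized.
have [a aP] := choice ex.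
pose sub c (Lc : L c) : set_type L := exist _ c (mem_set Lc).
pose h u := sub _ (aP u).
have [K KP] := synchronized_lines_bounded noflat.
have Lc0 : L c0.
  split=> // t s; rewrite (line_dist _ _ line_c0) mdistxx expr0n addr0.
  by rewrite real_normK ?num_real // -sqrrN opprB.
have [||||||||u] := @bounded_isometry_fixed_point R (set_type L)
  (fun u v => mdist (sval u 0) (sval v 0)) _ _ _ _ _ h
  (sub _ Lc0) K _ _ _.
- by move=> *; exact: mdist_ge0.
- by move=> *; exact: metric_sym.
- by move=> *; exact: metric_triangle.
- move=> u v; have h2 : 0 <= (2^-1 : R) <= 1 by apply/andP; split; lra.
  have [m [k [Lm bm]]] := between_synchronized 0 0 (set_valP u) (set_valP v) h2.
  exists (sub _ Lm) => w /=.
  (* Shifting the midpoint line into [L] brings its point at 0 no farther from [w]. *)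
  have := synchronized_min 0 (- k) (synchronized_linesP (set_valP w) Lm).
  rewrite addNr => le_m.
  have := between_cn catM (sval w 0) h2 (bm 0); rewrite !addr0.
  have : mdist (sval w 0) (m (0 + k)) ^+ 2 <= mdist (sval w 0) (m 0) ^+ 2.
    by rewrite ler_pXn2r ?nnegrE ?mdist_ge0.
  lra.
- move=> u /(synchronized_lines_complete (fun n => set_valP (u n)))[c Lc uc].
  by exists (sub _ Lc).
- by move=> u v; apply: KP; exact: set_valP.
- move=> u v; apply: isometry_shift_dist => //;
    by [exact: set_valP | exact: aP].
- move=> z; have [gz pz] := Lp _ (set_valP z).
  have [b Lb] := isometry_synchronized g'd pg' gz pz.
  pose y := sub _ Lb.
  exists y; apply/eqP; rewrite eq_le mdist_ge0 andbT.
  (* [h y] is a reparametrization of [z], hence passes through [sval z 0]; the least distance of the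
     two lines is 0. *)
  have := synchronized_min (- (b + a y)) 0
    (synchronized_linesP (aP y) (set_valP z)).
  have -> : g (sval y (- (b + a y) + a y)) = sval z 0.
    by rewrite /= g'K; congr (sval z _); ring.
  by rewrite mdistxx.
- move=> hu; exists (sval u), (- a u); split; first by case: (set_valP u).
  move=> t; have := synchronized_diag (t - a u)
    (synchronized_linesP (aP u) (set_valP u)).
  by rewrite subrK [X in _ = X -> _]hu => /mdist_positivity.
Qed.

End ParallelSet.

(** * Linear growth of orbits *)

Section OrbitGrowth.
Context {R : realType} {M : metricType R}.
Hypothesis catM : CAT0 M.
Implicit Types (g : M -> M) (x : M).

Lemma iter_distance_preserving g n : distance_preserving g ->
  distance_preserving (iter n g).
Proof. by move=> gd x y; elim: n => //= n IH; rewrite gd. Qed.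

Lemma iter_dist_le g n x : distance_preserving g ->
  mdist x (iter n g x) <= n%:R * mdist x (g x).
Proof.
move=> gd; elim: n => [|n IH]; first by rewrite mul0r mdistxx.
have := metric_triangle x (g x) (iter n.+1 g x).
rewrite iterS gd -natr1; lra.
Qed.

Lemma orbit_dist g k n x : distance_preserving g -> (k <= n)%N ->
  mdist (iter k g x) (iter n g x) = mdist x (iter (n - k) g x).
Proof.
by move=> gd kn; rewrite -{1}(subnKC kn) iterD iter_distance_preserving.
Qed.

(** If [m] is the midpoint of [x] and [g x], then [g m] is that of [g x] and [g (g x)]; the fan at
    [g x] bounds [d(m, g m)] by half of [d(x, g (g x))]. *)
Lemma displacement_double g (A : R) : distance_preserving g ->
  (forall x, A <= mdist x (g x)) -> forall x, 2 * A <= mdist x (g (g x)).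
Proof.
move=> gd gA x; have h2 : 0 <= (2^-1 : R) <= 1 by apply/andP; split; lra.
have [m bm] := between_exists catM x (g x) h2.
have bgm := isometry_between gd bm.
have E : 1 - 2^-1 = 2^-1 :> R by lra.
have := between_sym bm; rewrite E => /between_convex_fan - /(_ catM _ _ h2 bgm).
by have := gA m; lra.
Qed.

Lemma displacement_pow2 g (A : R) k : distance_preserving g ->
  (forall x, A <= mdist x (g x)) ->
  forall x, (2 ^ k)%:R * A <= mdist x (iter (2 ^ k) g x).
Proof.
move=> gd gA; elim: k => [|k IH] x; first by rewrite mul1r.
have := displacement_double (iter_distance_preserving (2 ^ k) gd) IH x.
by rewrite -iterD addnn -mul2n -expnS mulrA -natrM -expnS.
Qed.

(* Compare with the powers of 2 by Euclidean division of [2 ^ k] by [n]. *)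
Lemma displacement_iter g (A : R) n : distance_preserving g -> 0 <= A ->
  (forall x, A <= mdist x (g x)) -> forall x, n%:R * A <= mdist x (iter n g x).
Proof.
move=> gd A0 gA x; case: n => [|n']; first by rewrite mul0r mdist_ge0.
set n := n'.+1; set a := mdist x (iter n g x).
rewrite leNgt; apply/negP => lt_a.
have d0 : 0 < n%:R * A - a by rewrite subr_gt0.
(* With [2 ^ k = q * n + r], the deficit [q * (n * A - a)] is at most the cost [n * d(x, g x)] of
   the remainder; [q >= Q] forbids this, and [k = Q * n < 2 ^ k] ensures it. *)
have [Q QP] := exists_natr_gt (n%:R * mdist x (g x) / (n%:R * A - a)).
pose k := (Q * n)%N; pose q := (2 ^ k %/ n)%N; pose r := (2 ^ k %% n)%N.
have kE : (2 ^ k = r + q * n)%N by rewrite addnC -divn_eq.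
have Qq : (Q <= q)%N by rewrite leq_divRL // ltnW // ltn_expl.
have rn : (r <= n)%N by rewrite ltnW // ltn_mod.
have h1 := displacement_pow2 k gd gA x.
have : mdist x (iter (2 ^ k) g x) <= q%:R * a + r%:R * mdist x (g x).
  apply: le_trans (metric_triangle _ (iter r g x) _) _; rewrite addrC lerD //.
    rewrite orbit_dist ?kE ?leq_addr // addKn iterM.
    exact: iter_dist_le (iter_distance_preserving n gd).
  exact: iter_dist_le.
have : r%:R * mdist x (g x) <= n%:R * mdist x (g x).
  by rewrite ler_wpM2r ?mdist_ge0 // ler_nat.
have : Q%:R * (n%:R * A - a) <= q%:R * (n%:R * A - a).
  by rewrite ler_pM2r // ler_nat.
move: QP; rewrite ltr_pdivrMr //.
have : 0 <= r%:R * A by rewrite mulr_ge0.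
move: h1; rewrite kE natrD natrM; lra.
Qed.

(** The orbit of a nearly minimally displaced [p] stays within [d(x, p)] of that of [x], a constant
    absorbed for large [n]. *)
Lemma orbit_growth_le g (A : R) x e : distance_preserving g -> 0 < e ->
  (forall e, 0 < e -> exists p, mdist p (g p) <= A + e) ->
  exists N, forall n, (N <= n)%N -> mdist x (iter n g x) <= (A + e) * n%:R.
Proof.
move=> gd e0 gA; have e2 : 0 < e / 2 by rewrite divr_gt0.
have [p pP] := gA _ e2.
have [N NP] := exists_natr_gt (2 * mdist x p / (e / 2)); exists N => n Nn.
have h1 : mdist p (iter n g p) <= n%:R * mdist p (g p) by exact: iter_dist_le.
have h2 : n%:R * mdist p (g p) <= n%:R * (A + e / 2) by rewrite ler_wpM2l.
have h3 : mdist (iter n g p) (iter n g x) = mdist p x.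
  exact: iter_distance_preserving.
have h4 : 2 * mdist x p <= n%:R * (e / 2).
  rewrite -ler_pdivrMr //; apply: le_trans (ltW NP) _; by rewrite ler_nat.
have := metric_triangle x p (iter n g x).
have := metric_triangle p (iter n g p) (iter n g x).
rewrite h3 (metric_sym p x); lra.
Qed.

(** The first index exceeding the current record is a new record. *)
Lemma unbounded_records (b : nat -> R) : (forall B, exists n, B < b n) ->
  forall N, exists2 n, (N <= n)%N & forall k, (k <= n)%N -> b k <= b n.
Proof.
move=> ub; elim=> [|N [n Nn nP]].
  by exists 0%N => // k; rewrite leqn0 => /eqP ->.
have exn := ub (b n); case: (ex_minnP exn) => n' n'P minP.
exists n'; first by rewrite ltnNge; apply/negP => n'N;
  have := nP n' (leq_trans n'N Nn); rewrite leNgt n'P.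
move=> k; rewrite leq_eqVlt => /orP[/eqP -> //|kn'].
apply: le_trans (ltW n'P); rewrite leNgt; apply/negP => /minP.
by rewrite leqNgt kn'.
Qed.

(* At the record times [n] of [a n - (A - e) n], where [a n] is the distance from
   [x] to the [n]-th point of its orbit, the orbit up to time [n] fellow-travels
   the segment to its [n]-th point (Karlsson-Margulis). *)
Lemma orbit_sector g (A : R) x del : distance_preserving g -> 0 < A ->
  (forall x, A <= mdist x (g x)) ->
  (forall e, 0 < e -> exists p, mdist p (g p) <= A + e) -> 0 < del ->
  exists K, forall N, exists2 n, (N <= n)%N & forall k, (K <= k <= n)%N ->
    mdist x (iter k g x) <= mdist x (iter n g x) /\
    forall T u v, 0 <= T <= mdist x (iter k g x) ->
      between (T / mdist x (iter k g x)) x (iter k g x) u ->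
      between (T / mdist x (iter n g x)) x (iter n g x) v ->
      mdist u v <= del * T.
Proof.
move=> gd A0 gA gA' del0; pose a n := mdist x (iter n g x).
have aA n : n%:R * A <= a n by apply: displacement_iter => //; exact: ltW.
(* The bound [A] keeps the slope [A - e] nonnegative, so [a k <= a n] at records; the other one
   makes the final estimate at most [del * T]. *)
pose e := Num.min A (del ^+ 2 * A / 4).
have e0 : 0 < e by rewrite lt_min A0 !mulr_gt0 // ?exprn_gt0 // invr_gt0.
have eA : e <= A by rewrite ge_min lexx.
have edel : e <= del ^+ 2 * A / 4 by rewrite ge_min lexx orbT.
have [K KP] := orbit_growth_le x gd e0 gA'.
exists K.+1 => N.
have [B|n Nn nP] := @unbounded_records (fun n => a n - (A - e) * n%:R) _ N.
  have [n nP] := exists_natr_gt (B / e); exists n.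
  move: nP; rewrite ltr_pdivrMr //; have := aA n; lra.
exists n => // k /andP[Kk kn].
have k0 : 0 < k%:R :> R by rewrite ltr0n (leq_trans _ Kk).
have ak : 0 < a k by apply: lt_le_trans (aA k); rewrite mulr_gt0.
have akn : a k <= a n.
  have := nP k kn; have : 0 <= (A - e) * (n%:R - k%:R).
    by rewrite mulr_ge0 ?subr_ge0 // ler_nat.
  rewrite /=; lra.
split => // T u v /andP[T0 Tk] bu bv.
have an : 0 < a n by exact: lt_le_trans akn.
have l01 : 0 <= T / a k <= 1.
  by rewrite divr_ge0 ?(ltW ak) //= ler_pdivrMr // mul1r.
have m01 : 0 <= T / a n <= 1.
  by rewrite divr_ge0 ?(ltW an) //= ler_pdivrMr // mul1r (le_trans Tk).
have := two_sides_dist catM l01 m01 bu bv.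
rewrite -/(a k) -/(a n) orbit_dist // -/(a (n - k)%N) !divfK ?gt_eqF //.
rewrite subrr expr0n add0r.
have q1 : a (n - k)%N <= a n - (A - e) * k%:R.
  have := nP (n - k)%N (leq_subr _ _); rewrite /= natrB //; lra.
have q2 := KP k (ltnW Kk); rewrite -/(a k) in q2.
have t1 : a k <= a n + a (n - k)%N.
  have := metric_triangle x (iter n g x) (iter k g x).
  by rewrite (metric_sym (iter n g x)) orbit_dist.
have t2 : a n <= a k + a (n - k)%N.
  have := metric_triangle x (iter k g x) (iter n g x).
  by rewrite orbit_dist.
have t3 : a (n - k)%N <= a k + a n.
  have := metric_triangle (iter k g x) x (iter n g x).
  by rewrite (metric_sym (iter k g x) x) orbit_dist.
(* The factor [a (n - k) - a n + a k] is at most [2 * e * k] by [q1] and [q2], the other at most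
   [2 * a n]. *)
have ex1 : a (n - k)%N ^+ 2 - (a k - a n) ^+ 2 <= 4 * e * k%:R * a n.
  have -> : a (n - k)%N ^+ 2 - (a k - a n) ^+ 2 =
    (a (n - k)%N - a n + a k) * (a (n - k)%N + a n - a k) by ring.
  apply: le_trans (_ : (2 * e * k%:R) * (2 * a n) <= _); last by
    rewrite le_eqVlt; apply/orP; left; apply/eqP; ring.
  apply: ler_pM; lra.
move=> h; rewrite -(@ler_pXn2r _ 2) ?nnegrE ?mdist_ge0 ?mulr_ge0 ?(ltW del0) //.
apply: le_trans h _.
have lm0 : 0 <= T / a k * (T / a n).
  by rewrite mulr_ge0 //; [case/andP: l01|case/andP: m01].
apply: le_trans (ler_wpM2l lm0 ex1) _.
have -> : T / a k * (T / a n) * (4 * e * k%:R * a n) =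
    T ^+ 2 * (4 * e * k%:R) / a k by field; rewrite !gt_eqF.
rewrite ler_pdivrMr //.
have h1 : del ^+ 2 * (k%:R * A) <= del ^+ 2 * a k by rewrite ler_wpM2l ?sqr_ge0.
have h2 : e * k%:R <= del ^+ 2 * A / 4 * k%:R by rewrite ler_wpM2r // ltW.
have h3 : 4 * e * k%:R <= del ^+ 2 * a k by lra.
have := ler_wpM2l (sqr_ge0 T) h3; lra.
Qed.

End OrbitGrowth.

(** * Limit rays of orbits *)

Section Drift.
Context {R : realType} {M : completeMetricType R}.
Hypothesis catM : CAT0 M.
Implicit Types (g : M -> M) (x : M).

(** The segments from [x] to [iter k g x] form a Cauchy family at each parameter, as any two of them
    are compared with the segment to a later record point; [r] is their limit. *)
Lemma drift_ray g (A : R) x : distance_preserving g -> 0 < A ->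
  (forall x, A <= mdist x (g x)) ->
  (forall e, 0 < e -> exists p, mdist p (g p) <= A + e) ->
  exists r, [/\ geodesic_ray r, r 0 = x,
    forall t, 0 <= t -> mdist (g (r t)) (r t) <= mdist x (g x) &
    forall del, 0 < del -> exists K, forall k, (K <= k)%N ->
      mdist (iter k g x) (r (mdist x (iter k g x))) <=
      del * mdist x (iter k g x)].
Proof.
move=> gd A0 gA gA'; pose a n := mdist x (iter n g x).
have aA n : n%:R * A <= a n by apply: displacement_iter => //; exact: ltW.
have a_gt0 n : (0 < n)%N -> 0 < a n.
  by move=> n0; apply: lt_le_trans (aA n); rewrite mulr_gt0 // ltr0n.
have a_large T : exists N, forall n, (N <= n)%N -> T <= a n.
  have [N NP] := exists_natr_gt (T / A); exists N => n Nn.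
  apply: le_trans (aA n); rewrite -ler_pdivrMr //; apply: le_trans (ltW NP) _.
  by rewrite ler_nat.
have [s sP] := choice (fun k => CAT0_segment catM x (iter k g x)).
have s_dist k S T : 0 <= S <= a k -> 0 <= T <= a k ->
    mdist (s k S) (s k T) = `|S - T|.
  by move=> hS hT; case: (sP k) => _ _; apply; rewrite /= in_itv.
have s_between k T : (0 < k)%N -> 0 <= T <= a k ->
    0 <= T / a k <= 1 /\ between (T / a k) x (iter k g x) (s k T).
  move=> k0 /andP[T0 Tk]; have ak := a_gt0 k k0.
  have l01 : 0 <= T / a k <= 1.
    by rewrite divr_ge0 ?(ltW ak) //= ler_pdivrMr // mul1r.
  split=> //; have := segment_between (sP k) l01.
  by rewrite -/(a k) divfK // gt_eqF.
have s_close del : 0 < del -> exists2 K, (0 < K)%N &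
    forall j k T, (K <= j)%N -> (K <= k)%N -> 0 <= T -> T <= a j -> T <= a k ->
    mdist (s j T) (s k T) <= del * T.
  move=> del0; have del2 : 0 < del / 2 by rewrite divr_gt0.
  have [K KP] := orbit_sector catM x gd A0 gA gA' del2.
  exists K.+1 => // j k T Kj Kk T0 Tj Tk.
  have [n nN nP] := KP (maxn j k).
  have jn : (j <= n)%N by exact: leq_trans (leq_maxl _ _) nN.
  have kn : (k <= n)%N by exact: leq_trans (leq_maxr _ _) nN.
  have half i : (K < i)%N -> (i <= n)%N -> T <= a i ->
      mdist (s i T) (s n T) <= del / 2 * T.
    move=> Ki ni Ti; have [|ain] := nP i; first by rewrite ltnW.
    have Ti' : 0 <= T <= a i by rewrite T0.
    have Tn : 0 <= T <= a n by rewrite T0 (le_trans Ti).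
    have i0 : (0 < i)%N by exact: leq_ltn_trans Ki.
    apply; first exact: Ti'.
      exact: (s_between i T i0 Ti').2.
    exact: (s_between n T (leq_trans i0 ni) Tn).2.
  have := half j Kj jn Tj; have := half k Kk kn Tk.
  have := metric_triangle (s j T) (s n T) (s k T).
  rewrite (metric_sym (s n T)); lra.
have lim T : exists y, 0 <= T -> tends (s^~ T) y.
  (* [x] is a default value at negative parameters. *)
  have [T0|T0] := leP 0 T; last by exists x.
  have [|y yP] := @cauchy_tends _ _ (s^~ T); last by exists y.
  move=> e e0; have d0 : 0 < e / (T + 1) by rewrite divr_gt0 // ltr_wpDl.
  have [K _ KP] := s_close _ d0; have [N NP] := a_large T.
  exists (maxn K N) => j k; rewrite !geq_max => /andP[Kj Nj] /andP[Kk Nk].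
  apply: le_trans (KP j k T Kj Kk T0 (NP j Nj) (NP k Nk)) _.
  rewrite mulrAC ler_pdivrMr ?ltr_wpDl //; lra.
have [r rP] := choice lim; exists r; split.
- move=> S T; rewrite /= !in_itv /= !andbT => S0 T0.
  have [N NP] := a_large S; have [N' NP'] := a_large T.
  have sE n : (maxn N N' <= n)%N -> mdist (s n S) (s n T) = `|S - T|.
    by rewrite geq_max => /andP[Nn N'n]; rewrite s_dist ?S0 ?T0 ?NP ?NP'.
  apply/eqP; rewrite eq_le; apply/andP; split.
    apply: (tends_dist_le (rP S S0) (rP T T0)).
    by exists (maxn N N') => n /sE ->.
  apply: (tends_dist_ge (rP S S0) (rP T T0)).
  by exists (maxn N N') => n /sE ->.
- apply: mdist_positivity; apply/eqP; rewrite eq_le mdist_ge0 andbT.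
  apply: (tends_dist_le (rP 0 (lexx _)) (tends_cst x)); exists 0%N => n _.
  by case: (sP n) => -> _ _; rewrite mdistxx.
- move=> t t0.
  have gr : tends (fun n => g (s n t)) (g (r t)).
    by move=> e /(rP t t0)[N NP]; exists N => n Nn; rewrite gd NP.
  apply: (tends_dist_le gr (rP t t0)).
  have [N NP] := a_large t; exists N.+1 => n Nn.
  have tn : 0 <= t <= a n by rewrite t0 NP // ltnW.
  have [l01 b] := s_between n t (leq_ltn_trans (leq0n N) Nn) tn.
  (* Both ends of the segment are moved by [d(x, g x)], so convexity bounds the displacement in
     between. *)
  have := between_convex catM l01 (isometry_between gd b) b.
  rewrite (metric_sym (g x)) (metric_sym (g (iter n g x))).
  have -> : mdist (iter n g x) (g (iter n g x)) = mdist x (g x).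
    by rewrite -iterS iterSr iter_distance_preserving.
  lra.
- move=> del del0; have [K K0 KP] := s_close _ del0; exists K => k Kk.
  rewrite -/(a k); have ak : 0 <= a k by exact: mdist_ge0.
  apply: (tends_dist_le (tends_cst _) (rP _ ak)).
  have [N NP] := a_large (a k); exists (maxn K N) => n.
  rewrite geq_max => /andP[Kn Nn].
  have := KP k n (a k) Kk Kn ak (lexx _) (NP n Nn).
  by case: (sP k) => _ -> _.
Qed.

(** The distance between the rays is convex and bounded, hence nonincreasing, and starts at 0. *)
Lemma asymptotic_rays_eq (r r' : R -> M) : geodesic_ray r -> geodesic_ray r' ->
  asymptotic r r' -> r 0 = r' 0 -> forall t, 0 <= t -> r t = r' t.
Proof.
move=> gr gr' [K KP] r0 t t0.
have ray_between (c : R -> M) (x y l : R) :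
    geodesic_ray c -> 0 <= x -> 0 <= y -> 0 <= l <= 1 ->
    between l (c x) (c y) (c ((1 - l) * x + l * y)).
  move=> gc x0 y0 /andP[l0 l1].
  have l1' : 0 <= 1 - l by rewrite subr_ge0.
  split; rewrite !gc /= ?in_itv /= ?andbT ?addr_ge0 ?mulr_ge0 //.
  - rewrite (_ : x - _ = l * (x - y)); last by ring.
    by rewrite normrM ger0_norm.
  - rewrite (_ : _ - y = (1 - l) * (x - y)); last by ring.
    by rewrite normrM (@ger0_norm _ (1 - l)).
apply: mdist_positivity; apply/eqP; rewrite eq_le mdist_ge0 andbT.
rewrite -(mdistxx (r 0)) {2}r0.
apply: (@convex_bounded_nonincreasing _ (fun t => mdist (r t) (r' t)) K) => //.
move=> x y l x0 y0 l01.
by apply: (between_convex catM l01); exact: ray_between.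
Qed.

(* The orbits of [g] and of its inverse [g'] would both stay close to the same
   ray, but [iter k g x] and [iter k g' x] are [2 * k] steps apart. *)
Lemma drift_rays_not_asymptotic g g' (A : R) x r r' :
  distance_preserving g -> cancel g' g -> 0 < A ->
  (forall x, A <= mdist x (g x)) ->
  geodesic_ray r -> geodesic_ray r' -> r 0 = x -> r' 0 = x ->
  (forall del, 0 < del -> exists K, forall k, (K <= k)%N ->
     mdist (iter k g x) (r (mdist x (iter k g x))) <=
     del * mdist x (iter k g x)) ->
  (forall del, 0 < del -> exists K, forall k, (K <= k)%N ->
     mdist (iter k g' x) (r' (mdist x (iter k g' x))) <=
     del * mdist x (iter k g' x)) ->
  ~ asymptotic r r'.
Proof.
move=> gd g'K A0 gA gr gr' r0 r0' rP rP' arr'.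
have rE := asymptotic_rays_eq gr gr' arr' (etrans r0 (esym r0')).
have iterK k y : iter k g (iter k g' y) = y.
  by elim: k y => // k IH y; rewrite iterSr /= g'K IH.
set D := mdist x (g x); have D0 : 0 < D by exact: lt_le_trans (gA x).
(* Since [a <= k * D], each orbit point is within [k * A / 2] of [r a], whereas the two are at least
   [2 * k * A] apart. *)
have del0 : 0 < A / (2 * D) by rewrite divr_gt0 // mulr_gt0.
have [K KP] := rP _ del0; have [K' KP'] := rP' _ del0.
pose k := (maxn K K').+1; pose a := mdist x (iter k g x).
have aE : mdist x (iter k g' x) = a.
  by rewrite -(iter_distance_preserving k gd) iterK metric_sym.
have := KP k; rewrite leqW ?leq_maxl // -/a => /(_ isT) h1.
have := KP' k; rewrite leqW ?leq_maxr // aE => /(_ isT).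
rewrite -rE ?mdist_ge0 // => h2.
have h3 : (k + k)%:R * A <= mdist (iter k g' x) (iter k g x).
  rewrite -(iter_distance_preserving k gd) iterK -iterD.
  by apply: displacement_iter => //; exact: ltW.
have h4 : a <= k%:R * D by exact: iter_dist_le.
have h5 : A / (2 * D) * a <= A / (2 * D) * (k%:R * D) by rewrite ler_pM2l.
have h6 : A / (2 * D) * (k%:R * D) = k%:R * A / 2 by field; rewrite gt_eqF.
have h7 : 0 < k%:R * A by rewrite mulr_gt0 // ltr0n.
have := metric_triangle (iter k g' x) (r a) (iter k g x).
rewrite (metric_sym (r a)); move: h3; rewrite natrD; lra.
Qed.

End Drift.

(** * Hyperbolic isometries and positive translation length *)

Section Hyperbolicity.
Context {R : realType} {M : completeMetricType R} (g : M -> M).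
Hypothesis gd : distance_preserving g.

Lemma translation_length_le x : translation_length g <= mdist x (g x).
Proof.
rewrite metric_sym; apply: ge_inf; last by exists x.
by exists 0 => _ [p _ <-]; exact: mdist_ge0.
Qed.

Lemma le_translation_length (A : R) : (forall x, A <= mdist x (g x)) ->
  A <= translation_length g.
Proof.
move=> gA; apply: lb_le_inf.
  by exists (mdist (g point) point); exists point.
by move=> _ [p _ <-]; rewrite metric_sym.
Qed.

Lemma translation_length_approx e : 0 < e ->
  exists p, mdist p (g p) <= translation_length g + e.
Proof.
move=> e0; have [|_ [p _ <-] lt_p] :=
  @inf_adherent _ (range (fun p => mdist (g p) p)) e e0.
  split; first by exists (mdist (g point) point); exists point.
  by exists 0 => _ [p _ <-]; exact: mdist_ge0.
by exists p; rewrite metric_sym ltW.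
Qed.

(** On the axis [n] steps cover [n * |a|], and through [x] at most [2 * d(c 0, x) + n * d(x, g x)];
    for large [n] this forces [|a| <= d(x, g x)]. *)
Lemma hyperbolic_translation_length_gt0 :
  hyperbolic g -> 0 < translation_length g.
Proof.
move=> [c [gc [a a0 cP]]]; apply: lt_le_trans (_ : `|a| <= _).
  by rewrite normr_gt0.
apply: le_translation_length => x; rewrite leNgt; apply/negP => lt_a.
have d0 : 0 < `|a| - mdist x (g x) by rewrite subr_gt0.
have [n] := exists_natr_gt (2 * mdist (c 0) x / (`|a| - mdist x (g x))).
rewrite ltr_pdivrMr //.
have iterE : iter n g (c 0) = c (n%:R * a).
  elim: n => [|n IH]; first by rewrite mul0r.
  by rewrite iterS IH cP -natr1 mulrDl mul1r.
have : mdist (c 0) (iter n g (c 0)) = n%:R * `|a|.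
  by rewrite iterE (line_dist _ _ gc) sub0r normrN normrM ger0_norm.
have := iter_dist_le n x gd.
have := metric_triangle (c 0) x (iter n g (c 0)).
have := metric_triangle x (iter n g x) (iter n g (c 0)).
rewrite (iter_distance_preserving n gd) (metric_sym x (c 0)); lra.
Qed.

Hypothesis catM : CAT0 M.

Lemma visible_invariant_ends : visible M -> bijective g ->
  0 < translation_length g ->
  exists2 c, geodesic_line c & parallel c (g \o c).
Proof.
move=> vis [g' gK g'K] A0; pose x : M := point.
have g'd : distance_preserving g' by move=> y z; rewrite -gd !g'K.
have g'E p : mdist p (g' p) = mdist (g' p) (g (g' p)) by rewrite g'K metric_sym.
have [r [gr r0 rb rP]] :=
  drift_ray catM x gd A0 translation_length_le translation_length_approx.
have [|e e0|r' [gr' r'0 r'b r'P]] :=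
  drift_ray catM (A := translation_length g) x g'd A0.
- by move=> p; rewrite g'E; exact: translation_length_le.
- have [p pP] := translation_length_approx e0.
  by exists (g p); rewrite gK metric_sym.
have nasym := drift_rays_not_asymptotic catM gd g'K A0 translation_length_le
  gr gr' r0 r'0 rP r'P.
have refl c : geodesic_ray c -> endpoint c c.
  by move=> gc; split=> //; exists 0 => t _; rewrite mdistxx.
have [|||c [gc c'E cE]] := vis (endpoint r') (endpoint r).
- by exists r'.
- by exists r.
- move=> E; have : endpoint r r' by rewrite -E; exact: refl.
  by case.
have [_ [K cK]] : endpoint c r by rewrite cE; exact: refl.
have [_ [K' cK']] : endpoint (fun t => c (- t)) r' by rewrite c'E; exact: refl.
exists c => //; set b := mdist x (g x) in rb; set b' := mdist x (g' x) in r'b.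
(* Positive parameters are compared through [r], negative ones through [r'], which [g] moves as
   little as its inverse does. *)
exists (Num.max (K + b + K) (K' + b' + K')) => t /=; rewrite le_max.
have [t0|t0] := leP 0 t; apply/orP; [left|right].
  have := metric_triangle (c t) (r t) (g (c t)).
  have := metric_triangle (r t) (g (r t)) (g (c t)).
  have := cK t t0; have := rb t t0.
  by rewrite gd (metric_sym (g _)) (metric_sym (r t) (c t)); lra.
have nt0 : 0 <= - t by rewrite oppr_ge0 ltW.
have := cK' _ nt0; have := r'b _ nt0; rewrite opprK -gd g'K => h1 h2.
have := metric_triangle (c t) (r' (- t)) (g (c t)).
have := metric_triangle (r' (- t)) (g (r' (- t))) (g (c t)).
by rewrite gd (metric_sym (r' (- t)) (c t)); lra.
Qed.

Lemma translation_length_gt0_hyperbolic :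
  semi_uniformly_visible M -> bijective g -> 0 < translation_length g ->
  hyperbolic g.
Proof.
move=> [vis noflat] gbij A0.
have [c0 gc0 pc0] := visible_invariant_ends vis gbij A0.
have [c [a [gc cP]]] :=
  invariant_parallel_line catM gc0 (conj gbij gd) noflat pc0.
exists c; split=> //; exists a => //; apply/eqP => a0.
have := translation_length_le (c 0); rewrite cP a0 addr0 mdistxx.
by rewrite leNgt A0.
Qed.

End Hyperbolicity.

Theorem theorem1p3 (R : realType) (M : completeMetricType R) (g : M -> M) :
  CAT0 M -> semi_uniformly_visible M -> metric_isometry g ->
  [/\ elliptic g <-> (exists p : M, g p = p),
      hyperbolic g <-> 0 < translation_length g
    & parabolic g <->
        translation_length g = 0 /\ ~ (exists p : M, g p = p)].
Proof.
move=> catM vM [gbij gd].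
have hyp : hyperbolic g <-> 0 < translation_length g.
  split; first exact: hyperbolic_translation_length_gt0.
  exact: translation_length_gt0_hyperbolic.
have A0 : 0 <= translation_length g.
  by apply: le_translation_length => x; exact: mdist_ge0.
(* The first claim is the definition; the third negates the second, as the translation length is
   nonnegative. *)
split=> //; split=> [[nell nhyp]|[A_eq0 nell]]; split=> //.
- by apply/eqP; rewrite eq_le A0 andbT leNgt; apply/negP => /hyp.
- by move=> /hyp; rewrite A_eq0 ltxx.
Qed.
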